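(* Let $\Sigma=(\mathcal{X},\mathcal{X}_0,g,M)$ be an interconnected monotone system consisting of $N$ subsystems $\Sigma_i=(\mathcal{X}_i,\mathcal{X}_{0,i},\mathcal{W}_i,g_i)$, with unsafe set $\mathcal{X}_u=\prod_{i=1}^N\mathcal{X}_{u,i}$, $\mathcal{X}_{u,i}\subseteq\mathcal{X}_i$, and with state and input partitions having the covering properties described in the context. Fix $\lambda\ge 0$ common to all subsystems. Suppose that for each $i\in\{1,\ldots,N\}$ there is an interval-barrier function $\mathcal{B}_i:\mathcal{X}_i\to\mathbb{R}$ for $\Sigma_i$, with associated scalars $\gamma_i,\eta_i\in\mathbb{R}$ and symmetric matrix $X_i=\begin{bmatrix} X_i^{11} & X_i^{12} \\ X_i^{21} & X_i^{22} \end{bmatrix}\in\mathbb{R}^{(m_i+n_i)\times(m_i+n_i)}$. Define $$\Xi:=\begin{bmatrix}\operatorname{diag}(X_1^{11},\ldots,X_N^{11}) & \operatorname{diag}(X_1^{12},\ldots,X_N^{12}) \\ \operatorname{diag}(X_1^{21},\ldots,X_N^{21}) & \operatorname{diag}(X_1^{22},\ldots,X_N^{22})\end{bmatrix},$$ where $\operatorname{diag}$ denotes block-diagonal matrices. If $$\begin{bmatrix} M \\ I_n \end{bmatrix}^\top\Xi\begin{bmatrix} M \\ I_n \end{bmatrix}\preceq 0,\qquad \sum_{i=1}^N\gamma_i\le 0,\qquad \sum_{i=1}^N\eta_i>0,$$ then $\mathcal{B}(x)=\sum_{i=1}^N\mathcal{B}_i(x_i)$ is a barrier certificate for $\Sigma$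 with respect to $\mathcal{X}_u$, and hence $\Sigma$ is safe with respect to $\mathcal{X}_u$.
   Context: Notation: for vectors, $x\le y$ is coordinatewise; $[\underline{x},\overline{x}]=\{x:\underline{x}\le x\le\overline{x}\}$ (with $\underline{x}\le\overline{x}$); $A\preceq 0$ means the symmetric matrix $A$ is negative semidefinite; $I_n$ is the identity. Interconnected system: for $i\in\{1,\ldots,N\}$, $\Sigma_i=(\mathcal{X}_i,\mathcal{X}_{0,i},\mathcal{W}_i,g_i)$ has state set $\mathcal{X}_i\subseteq\mathbb{R}^{n_i}$, initial set $\mathcal{X}_{0,i}\subseteq\mathcal{X}_i$, internal input set $\mathcal{W}_i\subseteq\mathbb{R}^{m_i}$ and transition map $g_i:\mathcal{X}_i\times\mathcal{W}_i\to\mathcal{X}_i$, with $x_i^+=g_i(x_i,w_i)$. The subsystems are interconnected through $w=Mx$, where $x=(x_1^\top,\ldots,x_N^\top)^\top$, $w=(w_1^\top,\ldots,w_N^\top)^\top$, $M\in\mathbb{R}^{m\times n}$, $n=\sum_i n_i$, $m=\sum_i m_i$. Write $(Mx)_i\in\mathbb{R}^{m_i}$ for the $i$-th block of $Mx$; it is required that $(Mx)_i\in\mathcal{W}_i$ for all $x\in\prod_i\mathcal{X}_i$. The interconnected system is $\Sigma=(\mathcal{X},\mathcal{X}_0,g,M)$ with $\mathcal{X}=\prod_i\mathcal{X}_i$, $\mathcal{X}_0=\prod_i\mathcal{X}_{0,i}$, and $g:\mathcal{X}\to\mathcal{X}$, $g(x)=(g_1(x_1,(Mx)_1)^\top,\ldots,g_N(x_N,(Mx)_N)^\top)^\top$.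 It is an interconnected monotone system if each $\Sigma_i$ is monotone: $x\le y$ and $w\le v$ imply $g_i(x,w)\le g_i(y,v)$. Partitions: for each $i$ there are finite families of hyper-rectangles $\{[\underline{x}_i^j,\overline{x}_i^j]\}_{j\in\mathcal{P}_i}$ and $\{[\underline{w}_i^k,\overline{w}_i^k]\}_{k\in\mathcal{Q}_i}$ with $\mathcal{X}_i=\bigcup_{j\in\mathcal{P}_i}[\underline{x}_i^j,\overline{x}_i^j]$ and $\mathcal{W}_i=\bigcup_{k\in\mathcal{Q}_i}[\underline{w}_i^k,\overline{w}_i^k]$, and index sets $\mathcal{I}_i,\mathcal{U}_i\subseteq\mathcal{P}_i$ with $\mathcal{X}_{0,i}\subseteq\bigcup_{j\in\mathcal{I}_i}[\underline{x}_i^j,\overline{x}_i^j]$ and $\mathcal{X}_{u,i}\subseteq\bigcup_{j\in\mathcal{U}_i}[\underline{x}_i^j,\overline{x}_i^j]$. Interval product: for hyper-rectangles $[\underline{a},\overline{a}]\subseteq\mathbb{R}^p$, $[\underline{b},\overline{b}]\subseteq\mathbb{R}^q$ and $X\in\mathbb{R}^{p\times q}$, $$[\underline{a},\overline{a}]^\top X[\underline{b},\overline{b}]:=\sum_{r=1}^p\sum_{s=1}^q\min\{X_{rs}\underline{a}_r\underline{b}_s,\;X_{rs}\underline{a}_r\overline{b}_s,\;X_{rs}\overline{a}_r\underline{b}_s,\;X_{rs}\overline{a}_r\overline{b}_s\}.$$ Interval-barrier function: with $\lambda\ge0$ fixed (common to all subsystems), a monotone function $\mathcal{B}_i:\mathcal{X}_i\to\mathbb{R}$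 (i.e. $x\le y\Rightarrow\mathcal{B}_i(x)\le\mathcal{B}_i(y)$) is an interval-barrier function for $\Sigma_i$, with associated scalars $\gamma_i,\eta_i\in\mathbb{R}$ and symmetric matrix $X_i$ (blocks $X_i^{11}\in\mathbb{R}^{m_i\times m_i}$, $X_i^{12}\in\mathbb{R}^{m_i\times n_i}$, $X_i^{21}=(X_i^{12})^\top$, $X_i^{22}\in\mathbb{R}^{n_i\times n_i}$), if (1) $\mathcal{B}_i(\overline{x}_i^j)\le\gamma_i$ for all $j\in\mathcal{I}_i$; (2) $\mathcal{B}_i(\underline{x}_i^j)\ge\eta_i$ for all $j\in\mathcal{U}_i$; (3) $\mathcal{B}_i(g_i(\overline{x}_i^j,\overline{w}_i^k))\le\lambda\mathcal{B}_i(\underline{x}_i^j)+\mathcal{Z}_i^{j,k}$ for all $j\in\mathcal{P}_i$, $k\in\mathcal{Q}_i$, where $$\mathcal{Z}_i^{j,k}=[\underline{w}_i^k,\overline{w}_i^k]^\top X_i^{11}[\underline{w}_i^k,\overline{w}_i^k]+[\underline{w}_i^k,\overline{w}_i^k]^\top X_i^{12}[\underline{x}_i^j,\overline{x}_i^j]+[\underline{x}_i^j,\overline{x}_i^j]^\top X_i^{21}[\underline{w}_i^k,\overline{w}_i^k]+[\underline{x}_i^j,\overline{x}_i^j]^\top X_i^{22}[\underline{x}_i^j,\overline{x}_i^j].$$ Barrier certificate (for the overall system $x^+=g(x)$): a function $\mathcal{B}:\mathcal{X}\to\mathbb{R}$ is a barrier certificate with respect to $\mathcal{X}_u$ if there are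 $\gamma\le\delta\le\eta$ in $\mathbb{R}$ with $\mathcal{B}(x)\le\gamma$ for all $x\in\mathcal{X}_0$; $\mathcal{B}(x)>\eta$ for all $x\in\mathcal{X}_u$; and, for all $x\in\mathcal{X}$, $\mathcal{B}(x)\le\delta$ implies $\mathcal{B}(g(x))\le\delta$. Safety: $\Sigma$ is safe with respect to $\mathcal{X}_u$ if every trajectory $x_{t+1}=g(x_t)$ with $x_0\in\mathcal{X}_0$ satisfies $x_t\notin\mathcal{X}_u$ for all $t\ge0$. *)

(* Defs.v *)
From mathcomp Require Import all_boot all_order all_algebra.
From mathcomp Require Import boolp classical_sets reals.

Set Implicit Arguments.
Unset Strict Implicit.
Unset Printing Implicit Defensive.

Import Order.TTheory GRing.Theory Num.Theory.
Local Open Scope classical_set_scope.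
Local Open Scope ring_scope.

Section Vectors.
Variable R : realType.

Definition cvle n (x y : 'cV[R]_n) : Prop := forall k, x k 0 <= y k 0.

Definition hrect n (lo hi : 'cV[R]_n) : set 'cV[R]_n :=
  [set x | cvle lo x /\ cvle x hi].

(* A single number, not an interval: the sum of the termwise minima. *)
Definition interval_prod p q (alo ahi : 'cV[R]_p) (X : 'M[R]_(p, q))
    (blo bhi : 'cV[R]_q) : R :=
  \sum_(r < p) \sum_(s < q)
    Num.min (Num.min (X r s * alo r 0 * blo s 0) (X r s * alo r 0 * bhi s 0))
            (Num.min (X r s * ahi r 0 * blo s 0) (X r s * ahi r 0 * bhi s 0)).

Definition negsemidefinite n (A : 'M[R]_n) : Prop :=
  A^T = A /\ forall x : 'cV[R]_n, (x^T *m A *m x) 0 0 <= 0.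

(* Rectangular analogue of \mxdiag, to which it reduces when p_ = q_; the
   [conform_mx] only casts B_ i from width q_ i to q_ j when i = j. *)
Definition mxdiag_rect N (p_ q_ : 'I_N -> nat)
    (B_ : forall i, 'M[R]_(p_ i, q_ i)) : 'M[R]_(\sum_i p_ i, \sum_i q_ i) :=
  \mxblock_(i < N, j < N) if i == j then conform_mx 0 (B_ i) else 0.

Record hrect_family n (J : finType) := HrectFamily {
  hr_lo : J -> 'cV[R]_n;
  hr_hi : J -> 'cV[R]_n;
  hr_le : forall j, cvle (hr_lo j) (hr_hi j)
}.

Definition hr_union n (J : finType) (F : hrect_family n J) (D : {set J}) :
    set 'cV[R]_n :=
  \bigcup_(j in [set` D]) hrect (hr_lo F j) (hr_hi F j).

End Vectors.

Section Subsystems.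
Variable R : realType.

(* [sub_trans] is a total function, but only its values on
   [sub_state] x [sub_input] are ever constrained or relevant. *)
Record subsystem n m := Subsystem {
  sub_state : set 'cV[R]_n;
  sub_init : set 'cV[R]_n;
  sub_input : set 'cV[R]_m;
  sub_trans : 'cV[R]_n -> 'cV[R]_m -> 'cV[R]_n;
  sub_initS : sub_init `<=` sub_state;
  sub_transP : forall x w,
    sub_state x -> sub_input w -> sub_state (sub_trans x w)
}.

Definition monotone_subsystem n m (S : subsystem n m) : Prop :=
  forall x y w v, sub_state S x -> sub_state S y ->
    sub_input S w -> sub_input S v ->
    cvle x y -> cvle w v -> cvle (sub_trans S x w) (sub_trans S y v).

(* The matrix X is partitioned with the input coordinates first. *)
Definition intervalZ n m (X : 'M[R]_(m + n)) (xlo xhi : 'cV[R]_n)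
    (wlo whi : 'cV[R]_m) : R :=
  interval_prod wlo whi (ulsubmx X) wlo whi +
  interval_prod wlo whi (ursubmx X) xlo xhi +
  interval_prod xlo xhi (dlsubmx X) wlo whi +
  interval_prod xlo xhi (drsubmx X) xlo xhi.

Record interval_barrier n m (S : subsystem n m) (J K : finType)
    (PX : hrect_family R n J) (PW : hrect_family R m K) (I U : {set J})
    (lambda gamma eta : R) (X : 'M[R]_(m + n)) (B : 'cV[R]_n -> R) : Prop :=
  IntervalBarrier {
    ib_sym : X^T = X;
    ib_mono : forall x y, sub_state S x -> sub_state S y ->
      cvle x y -> B x <= B y;
    ib_init : forall j, j \in I -> B (hr_hi PX j) <= gamma;
    ib_unsafe : forall j, j \in U -> eta <= B (hr_lo PX j);
    ib_step : forall j k,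
      B (sub_trans S (hr_hi PX j) (hr_hi PW k)) <=
      lambda * B (hr_lo PX j) +
      intervalZ X (hr_lo PX j) (hr_hi PX j) (hr_lo PW k) (hr_hi PW k)
  }.

End Subsystems.

Section Interconnection.
Variables (R : realType) (N : nat) (n m : 'I_N -> nat).

Definition set_prod (A : forall i, set 'cV[R]_(n i)) :
    set 'cV[R]_(\sum_i n i) :=
  [set x | forall i, A i (submxcol x i)].

Record interconnected_system := InterconnectedSystem {
  is_sub : forall i, subsystem R (n i) (m i);
  is_M : 'M[R]_(\sum_i m i, \sum_i n i);
  is_MP : forall x, set_prod (fun i => sub_state (is_sub i)) x ->
    forall i, sub_input (is_sub i) (submxcol (is_M *m x) i)
}.

Variable S : interconnected_system.

Definition is_state : set 'cV[R]_(\sum_i n i) :=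
  set_prod (fun i => sub_state (is_sub S i)).

Definition is_init : set 'cV[R]_(\sum_i n i) :=
  set_prod (fun i => sub_init (is_sub S i)).

Definition is_trans (x : 'cV[R]_(\sum_i n i)) : 'cV[R]_(\sum_i n i) :=
  \mxcol_(i < N)
    sub_trans (is_sub S i) (submxcol x i) (submxcol (is_M S *m x) i).

Definition interconnected_monotone : Prop :=
  forall i, monotone_subsystem (is_sub S i).

Definition barrier_certificate (Xu : set 'cV[R]_(\sum_i n i))
    (B : 'cV[R]_(\sum_i n i) -> R) : Prop :=
  exists gamma delta eta : R,
    [/\ gamma <= delta /\ delta <= eta,
        forall x, is_init x -> B x <= gamma,
        forall x, Xu x -> eta < B x &
        forall x, is_state x -> B x <= delta -> B (is_trans x) <= delta].

Definition safe (Xu : set 'cV[R]_(\sum_i n i)) : Prop :=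
  forall x : nat -> 'cV[R]_(\sum_i n i),
    is_init (x 0%N) -> (forall t, x t.+1 = is_trans (x t)) ->
    forall t, ~ Xu (x t).

End Interconnection.

Definition Xi_mx (R : realType) N (n m : 'I_N -> nat)
    (X : forall i, 'M[R]_(m i + n i)) :
    'M[R]_(\sum_i m i + \sum_i n i) :=
  block_mx (\mxdiag_(i < N) ulsubmx (X i))
           (mxdiag_rect (fun i => ursubmx (X i)))
           (mxdiag_rect (fun i => dlsubmx (X i)))
           (\mxdiag_(i < N) drsubmx (X i)).

(* Main.v *)
(* If w_i = (Mx)_i, and (x_i, w_i) lies in a cell of the partition, then
   monotonicity of g_i and B_i bounds B_i(g_i(x_i, w_i)) by the value at the
   upper corner of the cell, and B_i(x_i) from below by the value at the lower
   corner. A bilinear form on a box is at least its interval product, so the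
   supply term Z_i is at most (w_i, x_i)^T X_i (w_i, x_i). Summing over i, these
   quadratic forms add up to that of [M; I]^T Xi [M; I], which is nonpositive;
   hence B(g(x)) <= lambda * B(x), and the certificate holds with all three
   levels equal to 0. *)
Require Import Defs.
From mathcomp Require Import all_boot all_order all_algebra.
From mathcomp Require Import boolp classical_sets reals.

Set Implicit Arguments.
Unset Strict Implicit.
Unset Printing Implicit Defensive.

Import Order.TTheory GRing.Theory Num.Theory.
Local Open Scope classical_set_scope.
Local Open Scope ring_scope.

Section IntervalProducts.
Variable R : realType.

(** A linear function on an interval is minimal at an endpoint; the sign of [c] decides which
    one. *)
Lemma ge_min_endpoint (c lo hi x : R) :
  lo <= x -> x <= hi -> Num.min (c * lo) (c * hi) <= c * x.
Proof.
move=> lox xhi; rewrite ge_min; have [c0|/ltW c0] := leP 0 c.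
  by rewrite ler_wpM2l.
by rewrite (ler_wnM2l c0 xhi) orbT.
Qed.

(** Each summand is linear in [a r 0] and in [b s 0] separately, so passing to endpoints in one
    variable and then in the other leaves the four corner values. *)
Lemma interval_prod_le p q (alo ahi a : 'cV[R]_p) (X : 'M[R]_(p, q))
    (blo bhi b : 'cV[R]_q) :
  hrect alo ahi a -> hrect blo bhi b ->
  interval_prod alo ahi X blo bhi <= (a^T *m X *m b) 0 0.
Proof.
move=> [aloa aahi] [blob bbhi].
rewrite -mulmxA mxE; apply: ler_sum => r _.
rewrite !mxE mulr_sumr; apply: ler_sum => s _.
have -> : a r 0 * (X r s * b s 0) = X r s * b s 0 * a r 0.
  by rewrite mulrC.
apply: le_trans (ge_min_endpoint _ (aloa r) (aahi r)).
(* With [a r 0] now at an endpoint, [b s 0] is moved last so that the one-variable bound applies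
   again. *)
rewrite !(mulrAC _ (b s 0)) le_min.
by apply/andP; split; rewrite ge_min; apply/orP; [left|right];
   exact: ge_min_endpoint.
Qed.

Lemma col_mx_form n m (X : 'M[R]_(m + n)) (w : 'cV[R]_m) (x : 'cV[R]_n) :
  (col_mx w x)^T *m X *m col_mx w x =
  w^T *m ulsubmx X *m w + w^T *m ursubmx X *m x +
  x^T *m dlsubmx X *m w + x^T *m drsubmx X *m x.
Proof.
rewrite -{1}(submxK X) tr_col_mx mul_row_block mul_row_col !mulmxDl.
by rewrite addrACA addrA.
Qed.

Lemma intervalZ_le n m (X : 'M[R]_(m + n)) (xlo xhi x : 'cV[R]_n)
    (wlo whi w : 'cV[R]_m) :
  hrect xlo xhi x -> hrect wlo whi w ->
  intervalZ X xlo xhi wlo whi <= ((col_mx w x)^T *m X *m col_mx w x) 0 0.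
Proof.
move=> xP wP; rewrite col_mx_form.
have addE (C D : 'M[R]_1) : (C + D) 0 0 = C 0 0 + D 0 0 by rewrite mxE.
by rewrite !addE !lerD ?interval_prod_le.
Qed.

Lemma hrect_lo n (lo hi : 'cV[R]_n) : cvle lo hi -> hrect lo hi lo.
Proof. by move=> le_lohi; split=> // k. Qed.

Lemma hrect_hi n (lo hi : 'cV[R]_n) : cvle lo hi -> hrect lo hi hi.
Proof. by move=> le_lohi; split=> // k. Qed.

Lemma hr_lo_union n (J : finType) (F : hrect_family R n J) (D : {set J}) j :
  j \in D -> hr_union F D (hr_lo F j).
Proof. by move=> jD; exists j => //; exact/hrect_lo/hr_le. Qed.

Lemma hr_hi_union n (J : finType) (F : hrect_family R n J) (D : {set J}) j :
  j \in D -> hr_union F D (hr_hi F j).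
Proof. by move=> jD; exists j => //; exact/hrect_hi/hr_le. Qed.

End IntervalProducts.

Section BlockDiagonal.
Variables (R : realType) (N : nat).

Lemma mxdiag_rect_form (p q : 'I_N -> nat) (D : forall i, 'M[R]_(p i, q i))
    (u : 'cV[R]_(\sum_i p i)) (v : 'cV[R]_(\sum_i q i)) :
  u^T *m mxdiag_rect D *m v =
  \sum_i (submxcol u i)^T *m D i *m submxcol v i.
Proof.
rewrite -{1}(submxcolK u) -{1}(submxcolK v) -mulmxA mul_mxblock_mxrow tr_mxcol.
rewrite mul_mxrow_mxcol; apply: eq_bigr => i _; rewrite -mulmxA.
rewrite (bigD1 i)//= eqxx conform_mx_id big1 ?addr0// => j.
by rewrite eq_sym => /negPf->; rewrite mul0mx.
Qed.

(** Up to a permutation of coordinates, [Xi_mx X] is the block-diagonal matrix of the [X i], so its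
    form decouples into the subsystems. *)
Lemma Xi_mx_form (n m : 'I_N -> nat) (X : forall i, 'M[R]_(m i + n i))
    (w : 'cV[R]_(\sum_i m i)) (x : 'cV[R]_(\sum_i n i)) :
  (col_mx w x)^T *m Xi_mx X *m col_mx w x =
  \sum_i (col_mx (submxcol w i) (submxcol x i))^T *m X i
          *m col_mx (submxcol w i) (submxcol x i).
Proof.
rewrite tr_col_mx mul_row_block mul_row_col !mulmxDl.
(* The square blocks [\mxdiag] unfold to the same term as [mxdiag_rect], so one lemma rewrites all
   four blocks. *)
rewrite !mxdiag_rect_form -!big_split /=.
by apply: eq_bigr => i _; rewrite col_mx_form addrACA !addrA.
Qed.

End BlockDiagonal.

Section Safety.
Variables (R : realType) (N : nat) (n m : 'I_N -> nat).
Variable S : interconnected_system R n m.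

Lemma is_init_state x : is_init S x -> is_state S x.
Proof. by move=> x0 i; exact: sub_initS (x0 i). Qed.

Lemma is_trans_state x : is_state S x -> is_state S (is_trans S x).
Proof.
by move=> xS i; rewrite mxcolK; apply: sub_transP; [exact: xS|exact: is_MP].
Qed.

Lemma barrier_certificate_safe Xu B : barrier_certificate S Xu B -> safe S Xu.
Proof.
move=> [gamma [delta [eta [[gd de] B0 Bu Bstep]]]] x x0 xS t xu.
(* Membership in the state set is part of the invariant because [Bstep] holds only there. *)
suff [_ Bt] : is_state S (x t) /\ B (x t) <= delta.
  by have := le_lt_trans (le_trans Bt de) (Bu _ xu); rewrite ltxx.
elim: t {xu} => [|t [xtS Bt]].
  by split; [exact: is_init_state|exact: le_trans (B0 _ x0) gd].
by rewrite xS; split; [exact: is_trans_state|exact: Bstep].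
Qed.

End Safety.

Section SubsystemBounds.
Variables (R : realType) (n m : nat) (S : subsystem R n m).
Variables (J K : finType) (PX : hrect_family R n J) (PW : hrect_family R m K).
Variables (I U : {set J}) (lambda gamma eta : R).
Variables (X : 'M[R]_(m + n)) (B : 'cV[R]_n -> R).
Hypothesis coverX : sub_state S = hr_union PX [set: J]%SET.
Hypothesis coverW : sub_input S = hr_union PW [set: K]%SET.
Hypothesis BP : interval_barrier S PX PW I U lambda gamma eta X B.

(** Monotonicity is assumed only on the state and input sets, so the corners used for comparison
    must belong to them. *)
Let lo_state j : sub_state S (hr_lo PX j).
Proof. by rewrite coverX; apply: hr_lo_union; rewrite inE. Qed.

Let hi_state j : sub_state S (hr_hi PX j).
Proof. by rewrite coverX; apply: hr_hi_union; rewrite inE. Qed.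

Lemma interval_barrier_init x :
  sub_state S x -> hr_union PX I x -> B x <= gamma.
Proof.
move=> xS [j jI [_ xhi]].
by apply: le_trans (ib_init BP jI); exact: ib_mono BP _ _ _ _ _.
Qed.

Lemma interval_barrier_unsafe x :
  sub_state S x -> hr_union PX U x -> eta <= B x.
Proof.
move=> xS [j jU [lox _]].
by apply: le_trans (ib_unsafe BP jU) _; exact: ib_mono BP _ _ _ _ _.
Qed.

Lemma interval_barrier_step x w :
    monotone_subsystem S -> 0 <= lambda -> sub_state S x -> sub_input S w ->
  B (sub_trans S x w) <=
  lambda * B x + ((col_mx w x)^T *m X *m col_mx w x) 0 0.
Proof.
move=> Smono lambda_ge0 xS wS.
(* The cells of [x] and [w] are chosen independently; [ib_step] covers every such pair. *)
have [j _ xj] : hr_union PX [set: J]%SET x by rewrite -coverX.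
have [k _ wk] : hr_union PW [set: K]%SET w by rewrite -coverW.
have whiS : sub_input S (hr_hi PW k).
  by rewrite coverW; apply: hr_hi_union; rewrite inE.
have [[lox xhi] [_ whi]] := (xj, wk).
have le_hi : B (sub_trans S x w) <= B (sub_trans S (hr_hi PX j) (hr_hi PW k)).
  apply: (ib_mono BP); [exact: sub_transP|exact: sub_transP|exact: Smono].
apply: le_trans le_hi (le_trans (ib_step BP j k) _).
apply: lerD; last exact: intervalZ_le.
(* The sign of [lambda] lets the lower-corner bound on [B x] pass through the product. *)
by apply: ler_wpM2l => //; exact: (ib_mono BP).
Qed.

End SubsystemBounds.

Theorem theorem2 (R : realType) (N : nat) (n m : 'I_N -> nat)
  (S : interconnected_system R n m)
  (S_mono : interconnected_monotone S)
  (Xu : forall i : 'I_N, set 'cV[R]_(n i))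
  (XuS : forall i, Xu i `<=` sub_state (is_sub S i))
  (P Q : 'I_N -> finType)
  (PX : forall i, hrect_family R (n i) (P i))
  (PW : forall i, hrect_family R (m i) (Q i))
  (I U : forall i, {set P i})
  (coverX : forall i, sub_state (is_sub S i) = hr_union (PX i) [set: P i]%SET)
  (coverW : forall i, sub_input (is_sub S i) = hr_union (PW i) [set: Q i]%SET)
  (coverI : forall i, sub_init (is_sub S i) `<=` hr_union (PX i) (I i))
  (coverU : forall i, Xu i `<=` hr_union (PX i) (U i))
  (lambda : R) (lambda_ge0 : 0 <= lambda)
  (B : forall i, 'cV[R]_(n i) -> R)
  (gamma eta : 'I_N -> R)
  (X : forall i, 'M[R]_(m i + n i))
  (BP : forall i, interval_barrier (is_sub S i) (PX i) (PW i) (I i) (U i)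
                    lambda (gamma i) (eta i) (X i) (B i))
  (XiP : negsemidefinite
           ((col_mx (is_M S) 1%:M)^T *m Xi_mx X *m col_mx (is_M S) 1%:M))
  (gammaP : \sum_(i < N) gamma i <= 0)
  (etaP : 0 < \sum_(i < N) eta i) :
  barrier_certificate S (set_prod Xu)
    (fun x => \sum_(i < N) B i (submxcol x i)) /\
  safe S (set_prod Xu).
Proof.
set Bsum := fun x : 'cV[R]_(\sum_i n i) => \sum_i B i (submxcol x i).
suff cert : barrier_certificate S (set_prod Xu) Bsum.
  by split=> //; exact: barrier_certificate_safe cert.
(* For every [lambda >= 0], the bound [lambda * Bsum x] is nonpositive as soon as [Bsum x] is, which
   singles out level 0. *)
exists 0, 0, 0; split=> // x.
- move=> x0; apply: le_trans gammaP; apply: ler_sum => i _.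
  apply: (interval_barrier_init (coverX i) (BP i)).
    exact: is_init_state x0 i.
  exact/coverI/x0.
- move=> xu; apply: lt_le_trans etaP _; apply: ler_sum => i _.
  apply: (interval_barrier_unsafe (coverX i) (BP i)).
    exact/XuS/xu.
  exact/coverU/xu.
- move=> xS Bx0; set w := is_M S *m x.
  have form_le0 : ((col_mx w x)^T *m Xi_mx X *m col_mx w x) 0 0 <= 0.
    have -> : col_mx w x = col_mx (is_M S) 1%:M *m x.
      by rewrite mul_col_mx mul1mx.
    by rewrite trmx_mul; have := XiP.2 x; rewrite !mulmxA.
  rewrite Xi_mx_form summxE in form_le0.
  apply: (@le_trans _ _ (lambda * Bsum x)); last exact: mulr_ge0_le0.
  (* The nonpositive form replaces the added 0, so that the goal splits into one step inequality per
     subsystem. *)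
  rewrite -[leRHS]addr0; apply: le_trans (lerD (lexx _) form_le0).
  rewrite mulr_sumr -big_split /=; apply: ler_sum => i _; rewrite mxcolK.
  apply: (interval_barrier_step (coverX i) (coverW i) (BP i)) => //.
  exact: is_MP.
Qed.
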